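(* Over $\mathsf{RCA}_0$, each of the following statements is equivalent to arithmetic comprehension (i.e., to $\mathsf{ACA}_0$): (1) Every discrete compact countable second-countable space is finite. (1') Every discrete effectively compact countable second-countable space is finite. (2) Every compact countable second-countable space is sequentially compact. (2') Every effectively compact countable second-countable space is sequentially compact.
   Context: All definitions are made in second-order arithmetic, over the base theory $\mathsf{RCA}_0$. Finite sets of natural numbers are coded by natural numbers; $I^{[<\infty]}$ denotes the set of all (codes of) finite subsets of $I$. An enumerable set is a nondecreasing sequence $A=\langle a_n\rangle_{n=0}^\infty$ of finite sets, representing $\bigcup_n a_n$ (which need not exist as a set); $x\in A$ abbreviates $(\exists n)(x\in a_n)$. Equivalently, an enumerable set is a $\Sigma^0_1$-definable class (parameters allowed). A countable second-countable space is a triple $(X,\mathcal U,k)$ where $X\subseteq\mathbb N$ is a set, $\mathcal U=\langle U_i\rangle_{i\in I}$ is an indexed sequence of subsets of $X$ and $k:X\times I\times I\to I$ is a function such that every $x\in X$ is in some $U_i$, and whenever $x\in U_i\cap U_j$ then $x\in U_{k(x,i,j)}\subseteq U_i\cap U_j$. The space is compact if for every enumerable set $A\subseteq I$ with $X=\bigcup_{i\in A}U_i$ there is a finite set $a\subseteq A$ with $X=\bigcup_{i\in a}U_i$. The sequence $\mathcal U$ has a finite cover relation if there is a set $C\subseteq I^{[<\infty]}$ such that for all finite $\{i_0,\dots,i_{\ell-1}\}\subseteq I$: $\{i_0,\dots,i_{\ell-1}\}\in C\leftrightarrow X=U_{i_0}\cup\cdots\cup U_{i_{\ell-1}}$. The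 space is effectively compact if it is compact and $\mathcal U$ has a finite cover relation. The space is discrete if for every $x\in X$ there is $i\in I$ with $U_i=\{x\}$. A point $x\in X$ is an accumulation point of a sequence $\langle x_n\rangle_{n=0}^\infty$ of points of $X$ if $\{n: x_n\in U_i\}$ is infinite for every $i\in I$ with $x\in U_i$; the space is sequentially compact if every sequence of points of $X$ has an accumulation point in $X$. *)

(* Defs.v *)
(** Structures for the (two-sorted, first-order) language of second-order
    arithmetic.  Set quantifiers range over [Sets], so these are Henkin
    structures; equality of sets is not primitive.  As usual in first-order
    logic both sorts are nonempty ([Num] contains [zero]).

    An assertion "over RCA_0" is read as: it holds in every such structure
    satisfying the axioms of RCA_0, which by the completeness theorem amounts
    to provability in RCA_0. *)
Record L2structure : Type := {
  Num : Type;
  zero : Num;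
  one : Num;
  add : Num -> Num -> Num;
  mul : Num -> Num -> Num;
  lt : Num -> Num -> Prop;
  Sets : Type;
  mem : Num -> Sets -> Prop;
  Sets_nonempty : inhabited Sets
}.

Arguments zero {_}.
Arguments one {_}.
Arguments add {_} _ _.
Arguments mul {_} _ _.
Arguments lt {_} _ _.
Arguments mem {_} _ _.

Declare Scope L2_scope.
Delimit Scope L2_scope with L2.
Bind Scope L2_scope with Num.
Open Scope L2_scope.
Notation "x + y" := (add x y) : L2_scope.
Notation "x * y" := (mul x y) : L2_scope.
Notation "x < y" := (lt x y) : L2_scope.
Notation "0" := zero : L2_scope.
Notation "1" := one : L2_scope.
Notation "x ∈ A" := (mem x A) (at level 70, no associativity) : L2_scope.

(** ** Arithmetical formulas

    Number variables are de Bruijn indices; set variables occur only as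
    parameters (an arithmetical formula has no set quantifiers), so they are
    plain names.  In [fAllB t phi] and [fExB t phi] the bound [t] lies outside
    the scope of the quantifier. *)
Inductive term : Type :=
| tVar : nat -> term
| tZero : term
| tOne : term
| tAdd : term -> term -> term
| tMul : term -> term -> term.

Inductive form : Type :=
| fEq : term -> term -> form
| fLt : term -> term -> form
| fMem : term -> nat -> form
| fNot : form -> form
| fAnd : form -> form -> form
| fOr : form -> form -> form
| fImp : form -> form -> form
| fAllB : term -> form -> form
| fExB : term -> form -> form
| fAll : form -> form
| fEx : form -> form.

Definition scons {T : Type} (x : T) (e : nat -> T) : nat -> T :=
  fun n => match n with O => x | S m => e m end.

Fixpoint teval {M : L2structure} (e : nat -> Num M) (t : term) : Num M :=
  match t with
  | tVar n => e n
  | tZero => 0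
  | tOne => 1
  | tAdd s t => teval e s + teval e t
  | tMul s t => teval e s * teval e t
  end.

Fixpoint sat {M : L2structure} (e : nat -> Num M) (E : nat -> Sets M)
    (phi : form) : Prop :=
  match phi with
  | fEq s t => teval e s = teval e t
  | fLt s t => teval e s < teval e t
  | fMem t X => teval e t ∈ E X
  | fNot p => ~ sat e E p
  | fAnd p q => sat e E p /\ sat e E q
  | fOr p q => sat e E p \/ sat e E q
  | fImp p q => sat e E p -> sat e E q
  | fAllB t p => forall x, x < teval e t -> sat (scons x e) E p
  | fExB t p => exists x, x < teval e t /\ sat (scons x e) E p
  | fAll p => forall x, sat (scons x e) E p
  | fEx p => exists x, sat (scons x e) E p
  end.

Fixpoint bounded (phi : form) : Prop :=
  match phi with
  | fEq _ _ | fLt _ _ | fMem _ _ => True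
  | fNot p => bounded p
  | fAnd p q | fOr p q | fImp p q => bounded p /\ bounded q
  | fAllB _ p | fExB _ p => bounded p
  | fAll _ | fEx _ => False
  end.

Definition Sigma01 (phi : form) : Prop :=
  exists theta, bounded theta /\ phi = fEx theta.

Definition Pi01 (phi : form) : Prop :=
  exists theta, bounded theta /\ phi = fAll theta.

(** ** Axioms

    In the schemes the distinguished number variable is index 0; quantifying
    over the assignments [e], [E] is the universal closure over all number and
    set parameters. *)
Definition basic_axioms (M : L2structure) : Prop :=
  (forall n : Num M, n + 1 <> 0) /\
  (forall m n : Num M, m + 1 = n + 1 -> m = n) /\
  (forall m : Num M, m + 0 = m) /\
  (forall m n : Num M, m + (n + 1) = (m + n) + 1) /\
  (forall m : Num M, m * 0 = 0) /\
  (forall m n : Num M, m * (n + 1) = (m * n) + m) /\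
  (forall m : Num M, ~ m < 0) /\
  (forall m n : Num M, m < n + 1 <-> (m < n \/ m = n)).

Definition Sigma01_induction (M : L2structure) : Prop :=
  forall (phi : form) (e : nat -> Num M) (E : nat -> Sets M),
    Sigma01 phi ->
    sat (scons 0 e) E phi ->
    (forall n, sat (scons n e) E phi -> sat (scons (n + 1) e) E phi) ->
    forall n, sat (scons n e) E phi.

Definition Delta01_comprehension (M : L2structure) : Prop :=
  forall (phi psi : form) (e : nat -> Num M) (E : nat -> Sets M),
    Sigma01 phi -> Pi01 psi ->
    (forall n, sat (scons n e) E phi <-> sat (scons n e) E psi) ->
    exists X : Sets M, forall n, n ∈ X <-> sat (scons n e) E phi.

Definition RCA0 (M : L2structure) : Prop :=
  basic_axioms M /\ Sigma01_induction M /\ Delta01_comprehension M.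

Definition arithmetical_comprehension (M : L2structure) : Prop :=
  forall (phi : form) (e : nat -> Num M) (E : nat -> Sets M),
    exists X : Sets M, forall n, n ∈ X <-> sat (scons n e) E phi.

(** ** Coding inside a structure

    From here on every definition abbreviates a formula of the language:
    quantifiers range over [Num M] and [Sets M] only, and a predicate argument
    of type [Num M -> Prop] stands for a definable class.

    Pairing is [(x + y)^2 + x]. *)
Definition cpair {M : L2structure} (x y : Num M) : Num M :=
  ((x + y) * (x + y)) + x.

Notation "⟨ x , y ⟩" := (cpair x y) (at level 0) : L2_scope.

(** A class is finite if it is bounded. *)
Definition is_finite {M : L2structure} (P : Num M -> Prop) : Prop :=
  exists b, forall x, P x -> x < b.

Definition is_infinite {M : L2structure} (P : Num M -> Prop) : Prop :=
  ~ is_finite P.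

(** Codes of finite sets, as in Simpson's _Subsystems of second order
    arithmetic_, II.2: [⟨k, ⟨m, n⟩⟩] represents the set of those [x < k] for
    which [m * (x + 1) + 1] divides [n], and the code of a finite set is its
    least representative.  Hence codes are unique. *)
Definition fin_rep {M : L2structure} (c : Num M) : Prop :=
  exists k m n, c = ⟨k, ⟨m, n⟩⟩.

Definition fin_mem {M : L2structure} (x c : Num M) : Prop :=
  exists k m n, c = ⟨k, ⟨m, n⟩⟩ /\ x < k /\
    exists q, n = q * ((m * (x + 1)) + 1).

Definition fin_code {M : L2structure} (c : Num M) : Prop :=
  fin_rep c /\
  forall d, d < c -> fin_rep d -> ~ (forall x, fin_mem x d <-> fin_mem x c).

(** [a] codes an element of [I^[<∞]]. *)
Definition fin_subset {M : L2structure} (a : Num M) (I : Sets M) : Prop :=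
  fin_code a /\ forall i, fin_mem i a -> i ∈ I.

(** [f], as a set of pairs, is a function from the class [D] to the class [R]. *)
Definition is_function {M : L2structure} (f : Sets M) (D R : Num M -> Prop)
    : Prop :=
  (forall p, p ∈ f -> exists x y, p = ⟨x, y⟩ /\ D x /\ R y) /\
  (forall x, D x -> exists y, ⟨x, y⟩ ∈ f) /\
  (forall x y z, ⟨x, y⟩ ∈ f -> ⟨x, z⟩ ∈ f -> y = z).

(** An enumerable set is a nondecreasing sequence of (codes of) finite sets. *)
Definition is_enumerable {M : L2structure} (A : Sets M) : Prop :=
  is_function A (fun _ => True) fin_code /\
  forall m n a b, m < n -> ⟨m, a⟩ ∈ A -> ⟨n, b⟩ ∈ A ->
    forall x, fin_mem x a -> fin_mem x b.

Definition enum_mem {M : L2structure} (x : Num M) (A : Sets M) : Prop :=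
  exists n a, ⟨n, a⟩ ∈ A /\ fin_mem x a.

(** ** Countable second-countable spaces *)

(** [nbhs] codes the sequence [⟨U_i⟩] for [i] in [idx], with
    [U_i = {x : ⟨x, i⟩ ∈ nbhs}]; [sel] is the graph of [k], the triple
    [(x, i, j)] being coded as [⟨x, ⟨i, j⟩⟩]. *)
Record space (M : L2structure) : Type := {
  pts : Sets M;
  idx : Sets M;
  nbhs : Sets M;
  sel : Sets M
}.

Arguments pts {_} _.
Arguments idx {_} _.
Arguments nbhs {_} _.
Arguments sel {_} _.

Definition U {M : L2structure} (S : space M) (i x : Num M) : Prop :=
  ⟨x, i⟩ ∈ nbhs S.

Definition is_csc_space {M : L2structure} (S : space M) : Prop :=
  (forall i x, i ∈ idx S -> U S i x -> x ∈ pts S) /\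
  is_function (sel S)
    (fun p => exists x i j,
       p = ⟨x, ⟨i, j⟩⟩ /\ x ∈ pts S /\ i ∈ idx S /\ j ∈ idx S)
    (fun l => l ∈ idx S) /\
  (forall x, x ∈ pts S -> exists i, i ∈ idx S /\ U S i x) /\
  (forall x i j l, x ∈ pts S -> i ∈ idx S -> j ∈ idx S ->
     ⟨⟨x, ⟨i, j⟩⟩, l⟩ ∈ sel S ->
     U S i x -> U S j x ->
     U S l x /\ forall y, U S l y -> U S i y /\ U S j y).

(** [X] is the union of the [U_i] for [i] in the class [J]. *)
Definition covers {M : L2structure} (S : space M) (J : Num M -> Prop) : Prop :=
  forall x, x ∈ pts S <-> exists i, J i /\ U S i x.

Definition compact {M : L2structure} (S : space M) : Prop :=
  forall A : Sets M,
    is_enumerable A ->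
    (forall i, enum_mem i A -> i ∈ idx S) ->
    covers S (fun i => enum_mem i A) ->
    exists a, fin_code a /\ (forall i, fin_mem i a -> enum_mem i A) /\
      covers S (fun i => fin_mem i a).

Definition has_finite_cover_relation {M : L2structure} (S : space M) : Prop :=
  exists C : Sets M,
    (forall a, a ∈ C -> fin_subset a (idx S)) /\
    (forall a, fin_subset a (idx S) ->
       (a ∈ C <-> covers S (fun i => fin_mem i a))).

Definition effectively_compact {M : L2structure} (S : space M) : Prop :=
  compact S /\ has_finite_cover_relation S.

Definition discrete {M : L2structure} (S : space M) : Prop :=
  forall x, x ∈ pts S ->
    exists i, i ∈ idx S /\ forall y, U S i y <-> y = x.

Definition finite_space {M : L2structure} (S : space M) : Prop :=
  is_finite (fun x => x ∈ pts S).

Definition point_sequence {M : L2structure} (S : space M) (s : Sets M) : Prop :=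
  is_function s (fun _ => True) (fun x => x ∈ pts S).

Definition accumulation_point {M : L2structure} (S : space M) (s : Sets M)
    (x : Num M) : Prop :=
  x ∈ pts S /\
  forall i, i ∈ idx S -> U S i x ->
    is_infinite (fun n => exists y, ⟨n, y⟩ ∈ s /\ U S i y).

Definition sequentially_compact {M : L2structure} (S : space M) : Prop :=
  forall s : Sets M, point_sequence S s -> exists x, accumulation_point S s x.

(** ** The four principles *)

Definition discrete_compact_finite (M : L2structure) : Prop :=
  forall S : space M,
    is_csc_space S -> discrete S -> compact S -> finite_space S.

Definition discrete_effectively_compact_finite (M : L2structure) : Prop :=
  forall S : space M,
    is_csc_space S -> discrete S -> effectively_compact S -> finite_space S.

Definition compact_sequentially_compact (M : L2structure) : Prop :=
  forall S : space M,
    is_csc_space S -> compact S -> sequentially_compact S.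

Definition effectively_compact_sequentially_compact (M : L2structure) : Prop :=
  forall S : space M,
    is_csc_space S -> effectively_compact S -> sequentially_compact S.

(* Main.v *)
Require Import Defs.
From Stdlib Require Import Classical Setoid Ring Arith Lia.
Open Scope L2_scope.

(** Under ACA_0, if a sequence [s] in a compact space has no accumulation point,
    the [U_i] containing [s_n] for only finitely many [n] cover the space; a
    finite subcover bounds all [n], which is absurd. In an infinite discrete
    space the sequence of the least points [>= n] has no accumulation point, so
    (2) gives (1) and (2') gives (1').

    Conversely, let [K = {u | exists r, Q u r}] be a Sigma01 class that is not a
    set. On the space of all numbers let [U_⟨z, t⟩] consist of [z] and of all [x]
    such that some [u < z] has a witness below [x] but none below [t]. Thus
    [U_⟨z, t⟩] is [{z}] when all members of [K] below [z] are witnessed below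
    [t], and otherwise contains a final segment. The space is discrete since
    such a [t] exists for each [z], by bounded Sigma01 comprehension. A cover
    without a member containing a final segment would compute [K], so the space
    is compact. It has a finite cover relation, because a finite family with
    indices below [b] covers everything as soon as it covers all [y <= b]. *)

(** * Substitution and merging of parameters *)

Fixpoint tsubst (s : nat -> term) (t : term) : term :=
  match t with
  | tVar n => s n
  | tZero => tZero
  | tOne => tOne
  | tAdd a b => tAdd (tsubst s a) (tsubst s b)
  | tMul a b => tMul (tsubst s a) (tsubst s b)
  end.

Definition up (s : nat -> term) : nat -> term :=
  fun n => match n with
           | O => tVar O
           | S m => tsubst (fun i => tVar (S i)) (s m)
           end.

Fixpoint fsubst (s : nat -> term) (g : nat -> nat) (phi : form) : form :=
  match phi with
  | fEq a b => fEq (tsubst s a) (tsubst s b)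
  | fLt a b => fLt (tsubst s a) (tsubst s b)
  | fMem a X => fMem (tsubst s a) (g X)
  | fNot p => fNot (fsubst s g p)
  | fAnd p q => fAnd (fsubst s g p) (fsubst s g q)
  | fOr p q => fOr (fsubst s g p) (fsubst s g q)
  | fImp p q => fImp (fsubst s g p) (fsubst s g q)
  | fAllB a p => fAllB (tsubst s a) (fsubst (up s) g p)
  | fExB a p => fExB (tsubst s a) (fsubst (up s) g p)
  | fAll p => fAll (fsubst (up s) g p)
  | fEx p => fEx (fsubst (up s) g p)
  end.

Lemma bounded_fsubst phi : forall s g, bounded phi -> bounded (fsubst s g phi).
Proof. induction phi; simpl; intuition. Qed.

Fixpoint double (n : nat) : nat :=
  match n with O => O | S m => S (S (double m)) end.

(** The sequence [c 0, d 0, c 1, d 1, ...]: two parameter assignments are packed into one from which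
    both can be read off. *)
Fixpoint interleave {T : Type} (n : nat) (c d : nat -> T) : T :=
  match n with
  | O => c O
  | S O => d O
  | S (S m) => interleave m (fun i => c (S i)) (fun i => d (S i))
  end.

Lemma interleave_even {T : Type} n :
  forall c d : nat -> T, interleave (double n) c d = c n.
Proof. induction n; simpl; intros; auto. Qed.

Lemma interleave_odd {T : Type} n :
  forall c d : nat -> T, interleave (S (double n)) c d = d n.
Proof. induction n; intros; [reflexivity|]. apply (IHn (fun i => c (S i))). Qed.

(** Variables below [k] are genuine, the others hold parameters. The recursion makes
    [glue (S k) (scons x e) c] convertible to [scons x (glue k e c)], so passing under a quantifier
    needs no rewriting. *)
Fixpoint glue {T : Type} (k : nat) (e c : nat -> T) : nat -> T :=
  match k with
  | O => c
  | S j => scons (e O) (glue j (fun n => e (S n)) c)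
  end.

Fixpoint lift (k : nat) (r : nat -> nat) (n : nat) : nat :=
  match k with
  | O => r n
  | S j => match n with O => O | S m => S (lift j r m) end
  end.

Lemma glue_lift {T : Type} (r : nat -> nat) (c d : nat -> T)
    (h : forall n, d (r n) = c n) k :
  forall e n, glue k e d (lift k r n) = glue k e c n.
Proof. induction k; simpl; auto. intros e [|n]; simpl; auto. Qed.

Lemma glue_lt {T : Type} k : forall j (e c : nat -> T),
  (j < k)%nat -> glue k e c j = e j.
Proof.
  induction k; intros j e c h; [lia|]. destruct j; simpl; auto.
  apply (IHk j (fun n => e (S n))). lia.
Qed.

Lemma glue_ge {T : Type} k : forall (e c : nat -> T) j,
  glue k e c (k + j)%nat = c j.
Proof. induction k; simpl; auto. Qed.

Section Definability.
Context {M : L2structure}.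
Notation num := (Num M).
Notation env := (nat -> Num M).

Lemma teval_ext t : forall e e' : env,
  (forall n, e n = e' n) -> teval e t = teval e' t.
Proof. induction t; simpl; intros; auto; f_equal; auto. Qed.

Lemma sat_ext phi : forall (e e' : env) (E E' : nat -> Sets M),
  (forall n, e n = e' n) -> (forall n, E n = E' n) ->
  sat e E phi <-> sat e' E' phi.
Proof.
  assert (up_ext : forall (e e' : env) (x : num), (forall n, e n = e' n) ->
    forall n, scons x e n = scons x e' n) by (intros e e' x h [|n]; simpl; auto).
  induction phi; simpl; intros e e' E E' he hE;
    rewrite ?(teval_ext t e e' he), ?(teval_ext t0 e e' he), ?hE;
    try tauto;
    try (rewrite (IHphi e e' E E' he hE); tauto);
    try (rewrite (IHphi1 e e' E E' he hE), (IHphi2 e e' E E' he hE); tauto).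
  1,3: split; intros h x; specialize (h x);
       specialize (IHphi _ _ E E' (up_ext e e' x he) hE); tauto.
  all: split; intros [x h]; exists x;
       specialize (IHphi _ _ E E' (up_ext e e' x he) hE); tauto.
Qed.

Lemma teval_subst t : forall (s : nat -> term) (e : env),
  teval e (tsubst s t) = teval (fun n => teval e (s n)) t.
Proof. induction t; simpl; intros; auto; f_equal; auto. Qed.

Lemma sat_subst phi : forall (s : nat -> term) g (e : env) (E : nat -> Sets M),
  sat e E (fsubst s g phi) <->
  sat (fun n => teval e (s n)) (fun X => E (g X)) phi.
Proof.
  assert (H : forall (s : nat -> term) (e : env) x n,
    teval (scons x e) (up s n) = scons x (fun n => teval e (s n)) n).
  { intros s e x [|n]; simpl; auto. rewrite teval_subst. reflexivity. }
  assert (H' : forall phi (s : nat -> term) g (e : env) E x,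
    (forall s g (e : env) E, sat e E (fsubst s g phi) <->
      sat (fun n => teval e (s n)) (fun X => E (g X)) phi) ->
    sat (scons x e) E (fsubst (up s) g phi) <->
    sat (scons x (fun n => teval e (s n))) (fun X => E (g X)) phi).
  { intros p s g e E x h. rewrite h. apply sat_ext; auto. }
  induction phi; simpl; intros s g e E; rewrite ?teval_subst; try tauto;
    try (rewrite IHphi; tauto); try (rewrite IHphi1, IHphi2; tauto).
  1,3: split; intros h x; specialize (h x);
       specialize (H' phi s g e E x IHphi); tauto.
  all: split; intros [x h]; exists x;
       specialize (H' phi s g e E x IHphi); tauto.
Qed.

(** * Predicates defined by bounded formulas with parameters *)

Definition term_with (c : env) (k : nat) (f : env -> num) : Prop :=
  exists t, forall e, teval (glue k e c) t = f e.

Definition Delta0_with (c : env) (E : nat -> Sets M) (k : nat)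
    (P : env -> Prop) : Prop :=
  exists theta, bounded theta /\
    forall e, sat (glue k e c) E theta <-> P e.

(** [P] is a bounded formula with parameters in the variables below [k]. *)
Definition Delta0 (k : nat) (P : env -> Prop) : Prop :=
  exists c E, Delta0_with c E k P.

Definition is_term (k : nat) (f : env -> num) : Prop :=
  exists c, term_with c k f.

Lemma term_with_ren c d r k f : (forall n, d (r n) = c n) ->
  term_with c k f -> term_with d k f.
Proof.
  intros h [t ht]. exists (tsubst (fun n => tVar (lift k r n)) t). intros e.
  rewrite teval_subst, <- ht. apply teval_ext. intros n. simpl.
  apply glue_lift, h.
Qed.

Lemma Delta0_with_ren c d E F r g k P :
  (forall n, d (r n) = c n) -> (forall n, F (g n) = E n) ->
  Delta0_with c E k P -> Delta0_with d F k P.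
Proof.
  intros h h' (t & hb & ht).
  exists (fsubst (fun n => tVar (lift k r n)) g t).
  split; [apply bounded_fsubst, hb|]. intros e.
  rewrite sat_subst, <- ht. apply sat_ext; auto. intros n. simpl.
  apply glue_lift, h.
Qed.

Definition merge {T : Type} (c d : nat -> T) : nat -> T :=
  fun n => interleave n c d.

Lemma term_with_l c d k f : term_with c k f -> term_with (merge c d) k f.
Proof. apply (term_with_ren _ _ double). intros n. apply interleave_even. Qed.

Lemma term_with_r c d k f : term_with d k f -> term_with (merge c d) k f.
Proof.
  apply (term_with_ren _ _ (fun n => S (double n))).
  intros n. apply interleave_odd.
Qed.

(** The parameters of [P] move to the even places and those of [Q] to the odd ones, so that a
    connective can join the two formulas. *)
Lemma Delta0_merge {j k P Q} : Delta0 j P -> Delta0 k Q ->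
  exists c E, Delta0_with c E j P /\ Delta0_with c E k Q.
Proof.
  intros (c & E & hP) (d & F & hQ).
  exists (merge c d), (merge E F). split.
  - revert hP. apply Delta0_with_ren with double double;
    intros n; apply interleave_even.
  - revert hQ. apply Delta0_with_ren with (fun n => S (double n))
      (fun n => S (double n)); intros n; apply interleave_odd.
Qed.

Lemma term_Delta0_merge {j k f Q} : is_term j f -> Delta0 k Q ->
  exists c E, term_with c j f /\ Delta0_with c E k Q.
Proof.
  intros (c & hP) (d & F & hQ).
  exists (merge c d), F. split.
  - apply term_with_l, hP.
  - revert hQ. apply Delta0_with_ren with (fun n => S (double n)) (fun n => n);
      intros n; auto; apply interleave_odd.
Qed.

Lemma term_merge {j k f g} : is_term j f -> is_term k g ->
  exists c, term_with c j f /\ term_with c k g.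
Proof.
  intros (c & hP) (d & hQ). exists (merge c d).
  split; [apply term_with_l, hP | apply term_with_r, hQ].
Qed.

Lemma is_term_var k j : (j < k)%nat -> is_term k (fun e => e j).
Proof.
  intros h. exists (fun _ => 0), (tVar j). intros e. simpl.
  apply (glue_lt k j e _ h).
Qed.

Lemma is_term_const k a : is_term k (fun _ => a).
Proof.
  exists (fun _ => a), (tVar k). intros e. simpl.
  rewrite <- (Nat.add_0_r k) at 2. apply glue_ge.
Qed.

Lemma is_term_add k f g : is_term k f -> is_term k g ->
  is_term k (fun e => f e + g e).
Proof.
  intros hf hg. destruct (term_merge hf hg) as (c & [s hs] & [t ht]).
  exists c, (tAdd s t). intros e. simpl. congruence.
Qed.

Lemma is_term_mul k f g : is_term k f -> is_term k g ->
  is_term k (fun e => f e * g e).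
Proof.
  intros hf hg. destruct (term_merge hf hg) as (c & [s hs] & [t ht]).
  exists c, (tMul s t). intros e. simpl. congruence.
Qed.

Lemma is_term_pair k f g : is_term k f -> is_term k g ->
  is_term k (fun e => ⟨f e, g e⟩).
Proof. intros. unfold cpair. auto using is_term_add, is_term_mul. Qed.

(** * Closure properties of bounded definability *)

Lemma Delta0_ext k P Q : (forall e, P e <-> Q e) -> Delta0 k P -> Delta0 k Q.
Proof.
  intros h (c & E & t & hb & ht). exists c, E, t. split; auto.
  intros e. rewrite ht. apply h.
Qed.

Lemma Delta0_eq k f g : is_term k f -> is_term k g ->
  Delta0 k (fun e => f e = g e).
Proof.
  intros hf hg. destruct (term_merge hf hg) as (c & [s hs] & [t ht]).
  destruct (Sets_nonempty M) as [X].
  exists c, (fun _ => X), (fEq s t). split; simpl; auto. intros e.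
  rewrite hs, ht. tauto.
Qed.

Lemma Delta0_lt k f g : is_term k f -> is_term k g ->
  Delta0 k (fun e => f e < g e).
Proof.
  intros hf hg. destruct (term_merge hf hg) as (c & [s hs] & [t ht]).
  destruct (Sets_nonempty M) as [X].
  exists c, (fun _ => X), (fLt s t). split; simpl; auto. intros e.
  rewrite hs, ht. tauto.
Qed.

Lemma Delta0_mem k f X : is_term k f -> Delta0 k (fun e => f e ∈ X).
Proof.
  intros (c & s & hs). exists c, (fun _ => X), (fMem s O).
  split; simpl; auto. intros e. rewrite hs. tauto.
Qed.

Lemma Delta0_not k P : Delta0 k P -> Delta0 k (fun e => ~ P e).
Proof.
  intros (c & E & t & hb & ht). exists c, E, (fNot t).
  split; simpl; auto. intros e. rewrite ht. tauto.
Qed.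

Lemma Delta0_and k P Q : Delta0 k P -> Delta0 k Q ->
  Delta0 k (fun e => P e /\ Q e).
Proof.
  intros hP hQ.
  destruct (Delta0_merge hP hQ) as (c & E & (t & hb & ht) & (t' & hb' & ht')).
  exists c, E, (fAnd t t'). split; simpl; auto. intros e.
  rewrite ht, ht'. tauto.
Qed.

Lemma Delta0_or k P Q : Delta0 k P -> Delta0 k Q ->
  Delta0 k (fun e => P e \/ Q e).
Proof.
  intros hP hQ.
  destruct (Delta0_merge hP hQ) as (c & E & (t & hb & ht) & (t' & hb' & ht')).
  exists c, E, (fOr t t'). split; simpl; auto. intros e.
  rewrite ht, ht'. tauto.
Qed.

Lemma Delta0_imp k P Q : Delta0 k P -> Delta0 k Q ->
  Delta0 k (fun e => P e -> Q e).
Proof.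
  intros hP hQ.
  destruct (Delta0_merge hP hQ) as (c & E & (t & hb & ht) & (t' & hb' & ht')).
  exists c, E, (fImp t t'). split; simpl; auto. intros e.
  rewrite ht, ht'. tauto.
Qed.

Lemma Delta0_iff k P Q : Delta0 k P -> Delta0 k Q ->
  Delta0 k (fun e => P e <-> Q e).
Proof. intros. apply Delta0_and; apply Delta0_imp; auto. Qed.

(** [P] is any proposition of the metatheory; classically it is equivalent to [0 = 0] or to its
    negation. *)
Lemma Delta0_const k (P : Prop) : Delta0 k (fun _ => P).
Proof.
  destruct (classic P) as [h|h].
  - apply Delta0_ext with (fun _ => 0 = 0 :> num); [tauto|].
    apply Delta0_eq; apply is_term_const.
  - apply Delta0_ext with (fun _ => ~ 0 = 0 :> num); [tauto|].
    apply Delta0_not, Delta0_eq; apply is_term_const.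
Qed.

Lemma Delta0_all_lt k f (Q : env -> num -> Prop) : is_term k f ->
  Delta0 (S k) (fun e => Q (fun n => e (S n)) (e O)) ->
  Delta0 k (fun e => forall x, x < f e -> Q e x).
Proof.
  intros hf hQ.
  destruct (term_Delta0_merge hf hQ) as (c & E & [s hs] & (t & hb & ht)).
  exists c, E, (fAllB s t). split; simpl; auto. intros e. rewrite hs.
  split; intros h x hx; apply (ht (scons x e)), h, hx.
Qed.

Lemma Delta0_ex_lt k f (Q : env -> num -> Prop) : is_term k f ->
  Delta0 (S k) (fun e => Q (fun n => e (S n)) (e O)) ->
  Delta0 k (fun e => exists x, x < f e /\ Q e x).
Proof.
  intros hf hQ.
  destruct (term_Delta0_merge hf hQ) as (c & E & [s hs] & (t & hb & ht)).
  exists c, E, (fExB s t). split; simpl; auto. intros e. rewrite hs.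
  split; intros (x & hx & h); exists x; split; auto; apply (ht (scons x e)), h.
Qed.

(** [glue] discards the entries from [k] on. This stands in for extensionality when an environment
    is rebuilt entry by entry. *)
Lemma Delta0_local k P : Delta0 k P -> forall e e',
  (forall i, (i < k)%nat -> e i = e' i) -> P e -> P e'.
Proof.
  intros (c & E & t & hb & ht) e e' h. rewrite <- !ht. apply sat_ext; auto.
  clear ht. revert e e' h.
  induction k; intros e e' h n; simpl; auto.
  destruct n; simpl. { rewrite h; auto. lia. }
  symmetry. apply IHk. intros i hi. symmetry. apply h. lia.
Qed.

(** The [k] substituted terms may have different parameters. They are merged one at a time, each
    merge pushing the parameters collected before to the odd places. *)
Lemma terms_glue j k : forall (f : nat -> env -> num) (c : env),
  (forall i, (i < k)%nat -> is_term j (f i)) ->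
  exists d (s : nat -> term), forall e n,
    teval (glue j e d) (s n) = glue k (fun i => f i e) c n.
Proof.
  induction k; intros f c h.
  - exists c, (fun n => tVar (j + n)). intros e n. apply glue_ge.
  - destruct (IHk (fun i => f (S i)) c) as (d & s & hs).
    { intros i hi. apply h. lia. }
    destruct (h O) as (d' & ht); [lia|].
    destruct (term_with_l _ d _ _ ht) as [t' ht'].
    exists (merge d' d), (fun n => match n with
      | O => t'
      | S m => tsubst (fun i => tVar (lift j (fun i => S (double i)) i)) (s m)
      end).
    intros e [|n]; simpl; [apply ht'|].
    rewrite <- hs, teval_subst. apply teval_ext. intros i. simpl.
    apply glue_lift. intros m. apply interleave_odd.
Qed.

(** Lets an abstract predicate, known to be bounded at the variables only, occur at arbitrary terms
    inside a larger formula. *)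
Lemma Delta0_subst j k P (f : nat -> env -> num) : Delta0 k P ->
  (forall i, (i < k)%nat -> is_term j (f i)) ->
  Delta0 j (fun e => P (fun i => f i e)).
Proof.
  intros (c & E & t & hb & ht) h.
  destruct (terms_glue j k f c h) as (d & s & hs).
  exists d, E, (fsubst s (fun n => n) t).
  split; [apply bounded_fsubst, hb|]. intros e.
  rewrite sat_subst, <- ht. apply sat_ext; auto.
Qed.

Lemma Delta0_subst1 (R : num -> Prop) k f :
  Delta0 1 (fun e => R (e O)) -> is_term k f -> Delta0 k (fun e => R (f e)).
Proof.
  intros hR hf. apply (Delta0_subst k 1 _ (fun _ => f) hR). auto.
Qed.

Lemma Delta0_subst2 (R : num -> num -> Prop) k f g :
  Delta0 2 (fun e => R (e O) (e 1%nat)) -> is_term k f -> is_term k g ->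
  Delta0 k (fun e => R (f e) (g e)).
Proof.
  intros hR hf hg.
  apply (Delta0_subst k 2 _ (fun i => match i with O => f | _ => g end) hR).
  intros [|i]; auto.
Qed.

End Definability.

(** * Automation for bounded definability *)

Ltac delta0_step :=
  match goal with
  | |- is_term _ _ =>
    first [ simple apply is_term_const | simple apply is_term_pair
          | simple apply is_term_add | simple apply is_term_mul
          | simple apply is_term_var; lia ]
  | |- Delta0 _ _ =>
    first [ simple apply Delta0_const
          | simple apply Delta0_all_lt | simple apply Delta0_ex_lt
          | simple apply Delta0_iff | simple apply Delta0_and
          | simple apply Delta0_or
          | simple apply Delta0_not
          | simple apply Delta0_imp | simple apply Delta0_eq
          | simple apply Delta0_lt | simple apply Delta0_mem ]
  end; cbv beta.

(** Goals about coded finite sets, or about abstract predicates that no hypothesis closes, are left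
    to the caller. *)
Ltac delta0 := repeat first [ solve [eauto 3 with nocore] | delta0_step ].

(** As a strict inequality this needs no rule of its own in [delta0], and a bound [x < p + 1] is
    literally [x <= p]. *)
Notation "x <= y" := (lt x (add y one)) : L2_scope.

Section RCA.
Context {M : L2structure} (hM : RCA0 M).
Notation num := (Num M).
Notation env := (nat -> Num M).

(** * Induction and comprehension *)

Lemma Sigma1_ind (Q : num -> num -> Prop) :
  Delta0 2 (fun e => Q (e 1%nat) (e O)) ->
  (exists y, Q 0 y) -> (forall n, (exists y, Q n y) -> exists y, Q (n + 1) y) ->
  forall n, exists y, Q n y.
Proof.
  intros (c & E & t & hb & ht) h0 hS.
  assert (H : forall n, sat (scons n c) E (fEx t) <-> exists y, Q n y).
  { intros n. simpl. split; intros [y hy]; exists y;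
    apply (ht (scons y (scons n c))), hy. }
  intros n. apply H. destruct hM as (_ & hI & _).
  apply hI; [exists t; auto | apply H, h0 | ].
  intros m hm. apply H, hS, H, hm.
Qed.

Lemma Delta0_ind (P : num -> Prop) : Delta0 1 (fun e => P (e O)) ->
  P 0 -> (forall n, P n -> P (n + 1)) -> forall n, P n.
Proof.
  intros hP h0 hS n.
  destruct (Sigma1_ind (fun n _ => P n)) with n as [_ h]; auto.
  - apply (Delta0_subst1 P 2 (fun e => e 1%nat) hP). delta0.
  - exists 0; auto.
  - intros m [_ h]. exists 0. auto.
Qed.

Lemma Delta1_comprehension (Q R : num -> num -> Prop) :
  Delta0 2 (fun e => Q (e 1%nat) (e O)) ->
  Delta0 2 (fun e => R (e 1%nat) (e O)) ->
  (forall n, (exists y, Q n y) <-> (forall y, R n y)) ->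
  exists X, forall n, n ∈ X <-> exists y, Q n y.
Proof.
  intros hQ hR h.
  destruct (Delta0_merge hQ hR) as (c & E & (t & hb & ht) & (t' & hb' & ht')).
  assert (H : forall n, sat (scons n c) E (fEx t) <-> exists y, Q n y).
  { intros n. simpl. split; intros [y hy]; exists y;
    apply (ht (scons y (scons n c))), hy. }
  assert (H' : forall n, sat (scons n c) E (fAll t') <-> forall y, R n y).
  { intros n. simpl. split; intros hy y; specialize (hy y);
    apply (ht' (scons y (scons n c))), hy. }
  destruct hM as (_ & _ & hC).
  destruct (hC (fEx t) (fAll t') c E) as [X hX].
  - exists t; auto.
  - exists t'; auto.
  - intros n. rewrite H, H'. apply h.
  - exists X. intros n. rewrite hX. apply H.
Qed.

Lemma Delta0_comprehension (P : num -> Prop) : Delta0 1 (fun e => P (e O)) ->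
  exists X, forall n, n ∈ X <-> P n.
Proof.
  intros hP.
  assert (h : Delta0 2 (fun e => P (e 1%nat))).
  { apply (Delta0_subst1 P 2 (fun e => e 1%nat) hP). delta0. }
  destruct (Delta1_comprehension (fun n _ => P n) (fun n _ => P n) h h)
    as [X hX].
  - intros n. split; [intros [_ hn]; auto | intros hn; exists 0; auto].
  - exists X. intros n. rewrite hX.
    split; [intros [_ hn]; auto | intros hn; exists 0; auto].
Qed.

(** * Arithmetic *)

Lemma succ_neq_0 (n : num) : n + 1 <> 0.
Proof. apply hM. Qed.
Lemma succ_inj (m n : num) : m + 1 = n + 1 -> m = n.
Proof. apply hM. Qed.
Lemma add_0_r (m : num) : m + 0 = m.
Proof. apply hM. Qed.
Lemma add_succ_r (m n : num) : m + (n + 1) = (m + n) + 1.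
Proof. apply hM. Qed.
Lemma mul_0_r (m : num) : m * 0 = 0.
Proof. apply hM. Qed.
Lemma mul_succ_r (m n : num) : m * (n + 1) = (m * n) + m.
Proof. apply hM. Qed.
Lemma not_lt_0 (m : num) : ~ m < 0.
Proof. apply hM. Qed.
Lemma lt_succ (m n : num) : m <= n <-> (m < n \/ m = n).
Proof. apply hM. Qed.

Lemma add_0_l (n : num) : 0 + n = n.
Proof.
  revert n. refine (Delta0_ind _ _ _ _); [delta0 | apply add_0_r |].
  intros n h. rewrite add_succ_r, h. reflexivity.
Qed.

Lemma add_assoc (a b n : num) : a + (b + n) = (a + b) + n.
Proof.
  revert n. refine (Delta0_ind _ _ _ _); [delta0 | rewrite !add_0_r; auto |].
  intros n h. rewrite !add_succ_r, h. reflexivity.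
Qed.

Lemma add_1_comm (n : num) : 1 + n = n + 1.
Proof.
  revert n. refine (Delta0_ind _ _ _ _); [delta0 | rewrite add_0_r, add_0_l; auto |].
  intros n h. rewrite add_succ_r, h. reflexivity.
Qed.

Lemma add_comm (m n : num) : m + n = n + m.
Proof.
  revert n. refine (Delta0_ind _ _ _ _); [delta0 | rewrite add_0_r, add_0_l; auto |].
  intros n h. rewrite add_succ_r, h, <- add_assoc, <- add_1_comm, add_assoc.
  reflexivity.
Qed.

Lemma add_swap (a b c d : num) : (a + b) + (c + d) = (a + c) + (b + d).
Proof.
  rewrite <- !add_assoc. f_equal. rewrite !add_assoc. f_equal. apply add_comm.
Qed.

Lemma mul_0_l (n : num) : 0 * n = 0.
Proof.
  revert n. refine (Delta0_ind _ _ _ _); [delta0 | apply mul_0_r |].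
  intros n h. rewrite mul_succ_r, h. apply add_0_r.
Qed.

Lemma mul_1_l (n : num) : 1 * n = n.
Proof.
  revert n. refine (Delta0_ind _ _ _ _); [delta0 | apply mul_0_r |].
  intros n h. rewrite mul_succ_r, h. reflexivity.
Qed.

Lemma mul_add_l (a b n : num) : (a + b) * n = a * n + b * n.
Proof.
  revert n. refine (Delta0_ind _ _ _ _); [delta0 | rewrite !mul_0_r, add_0_r; auto |].
  intros n h. rewrite !mul_succ_r, h. apply add_swap.
Qed.

Lemma mul_comm (m n : num) : m * n = n * m.
Proof.
  revert n. refine (Delta0_ind _ _ _ _); [delta0 | rewrite mul_0_r, mul_0_l; auto |].
  intros n h. rewrite mul_succ_r, h, mul_add_l, mul_1_l. reflexivity.
Qed.

Lemma mul_assoc (a b n : num) : a * (b * n) = (a * b) * n.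
Proof.
  revert n. refine (Delta0_ind _ _ _ _); [delta0 | rewrite !mul_0_r; auto |].
  intros n h. rewrite !mul_succ_r, (mul_comm a), mul_add_l.
  rewrite (mul_comm _ a), h, (mul_comm b a). reflexivity.
Qed.

Lemma num_semiring :
  semi_ring_theory (@zero M) (@one M) (@add M) (@mul M) (@eq num).
Proof.
  constructor; auto using add_0_l, add_comm, add_assoc, mul_1_l, mul_0_l,
    mul_comm, mul_assoc, mul_add_l.
Qed.

Add Ring num_ring : num_semiring.

Lemma add_cancel_r (a b n : num) : a + n = b + n -> a = b.
Proof.
  revert n. refine (Delta0_ind _ _ _ _); [delta0 | rewrite !add_0_r; auto |].
  intros n h. rewrite !add_succ_r. intros h'. apply h, succ_inj, h'.
Qed.

Lemma add_cancel_l (a b n : num) : n + a = n + b -> a = b.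
Proof. rewrite !(add_comm n). apply add_cancel_r. Qed.

Lemma neq_add_succ (a d : num) : a <> a + d + 1.
Proof.
  intros h. apply (succ_neq_0 d). apply (add_cancel_l _ _ a).
  rewrite add_assoc, add_0_r. auto.
Qed.

Lemma zero_or_succ (n : num) : n = 0 \/ exists m, n = m + 1.
Proof.
  destruct (Sigma1_ind (fun n y => n = 0 \/ n = y + 1)) with n as [y h];
    [delta0 | exists 0; auto | | ].
  - intros m _. exists m. auto.
  - destruct h; eauto.
Qed.

Lemma add_eq_0 (a b : num) : a + b = 0 -> a = 0 /\ b = 0.
Proof.
  intros h. assert (hb : b = 0).
  { destruct (zero_or_succ b) as [e|[m e]]; auto. subst.
    rewrite add_assoc in h. contradiction (succ_neq_0 _ h). }
  subst. rewrite add_0_r in h. auto.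
Qed.

Lemma lt_add (a d : num) : a < a + d + 1.
Proof.
  revert d. refine (Delta0_ind _ _ _ _); [delta0 | |].
  - apply lt_succ. right. ring.
  - intros d h. apply lt_succ. left. rewrite add_assoc. exact h.
Qed.

(** Together with [lt_add] this trades an inequality for an equation with an explicit difference,
    which [ring] can treat in a semiring. *)
Lemma lt_ex (a b : num) : a < b -> exists d, b = a + d + 1.
Proof.
  intros h.
  destruct (Sigma1_ind (fun b d => a < b -> b = a + d + 1)) with b as [d hd];
    [delta0 | | | eauto].
  (* A default witness, as the premise [a < 0] fails. *)
  - exists 0. intros h0. contradiction (not_lt_0 _ h0).
  - intros n [d hd]. destruct (classic (a < n)) as [h1|h1].
    + exists (d + 1). intros _. rewrite (hd h1) at 1. ring.
    + exists 0. intros h2. apply lt_succ in h2. destruct h2; [tauto|].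
      subst. ring.
Qed.

Lemma le_add (a d : num) : a <= a + d.
Proof. apply lt_add. Qed.

Lemma le_ex (a b : num) : a <= b -> exists d, b = a + d.
Proof. intros h. destruct (lt_ex _ _ h) as [d hd]. exists d. apply succ_inj, hd. Qed.

Lemma lt_irrefl (a : num) : ~ a < a.
Proof. intros h. destruct (lt_ex _ _ h) as [d hd]. apply (neq_add_succ _ _ hd). Qed.

Lemma lt_trans (a b c : num) : a < b -> b < c -> a < c.
Proof.
  intros h h'. destruct (lt_ex _ _ h) as [d ->].
  destruct (lt_ex _ _ h') as [d' ->].
  replace (a + d + 1 + d' + 1) with (a + (d + d' + 1) + 1) by ring. apply lt_add.
Qed.

Lemma lt_le_trans (a b c : num) : a < b -> b <= c -> a < c.
Proof. intros h h'. apply lt_succ in h'. destruct h' as [h'| <-]; eauto using lt_trans. Qed.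

Lemma le_lt_trans (a b c : num) : a <= b -> b < c -> a < c.
Proof. intros h h'. apply lt_succ in h. destruct h as [h| ->]; eauto using lt_trans. Qed.

Lemma lt_le (a b : num) : a < b -> a <= b.
Proof. intros h. apply lt_succ. auto. Qed.

Lemma le_refl (a : num) : a <= a.
Proof. apply lt_succ. auto. Qed.

Lemma le_trans (a b c : num) : a <= b -> b <= c -> a <= c.
Proof. intros h h'. apply (le_lt_trans a b); auto. Qed.

Lemma zero_le (a : num) : 0 <= a.
Proof. rewrite <- (add_0_l a). apply le_add. Qed.

Lemma trichotomy (a b : num) : a < b \/ a = b \/ b < a.
Proof.
  revert b. refine (Delta0_ind _ _ _ _); [delta0 | |].
  - destruct (zero_or_succ a) as [ ->|[m ->]]; auto. right. right. apply zero_le.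
  - intros n [h|[ ->|h]].
    + left. apply lt_le, h.
    + left. apply le_refl.
    + right. destruct (lt_ex _ _ h) as [d ->].
      destruct (zero_or_succ d) as [ ->|[m ->]].
      * left. ring.
      * right. replace (n + (m + 1) + 1) with (n + 1 + m + 1) by ring.
        apply lt_add.
Qed.

Lemma lt_or_le (a b : num) : a < b \/ b <= a.
Proof.
  destruct (trichotomy a b) as [h|[ ->|h]]; auto using le_refl, lt_le.
Qed.

Lemma not_le_lt (a b : num) : a <= b -> ~ b < a.
Proof. intros h h'. apply (lt_irrefl a). apply (le_lt_trans a b); auto. Qed.

Lemma le_add_l (a d : num) : a <= d + a.
Proof. rewrite (add_comm d). apply le_add. Qed.

Lemma le_mul_succ (a b : num) : a <= a * (b + 1).
Proof. replace (a * (b + 1)) with (a + a * b) by ring. apply le_add. Qed.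

Lemma le_square (a : num) : a <= a * a.
Proof.
  destruct (zero_or_succ a) as [ ->|[m ->]]; [apply zero_le | apply le_mul_succ].
Qed.

Lemma le_pair_l (x y : num) : x <= ⟨x, y⟩.
Proof. apply le_add_l. Qed.

Lemma le_pair_r (x y : num) : y <= ⟨x, y⟩.
Proof.
  apply (le_trans _ (x + y)); [apply le_add_l|].
  apply (le_trans _ _ _ (le_square _)). apply le_add.
Qed.

(** The next square after [(x + y) * (x + y)] exceeds it by more than [x], so pairs with different
    sums lie in disjoint intervals. *)
Lemma pair_lt (x y x' y' : num) : x + y < x' + y' -> ⟨x, y⟩ < ⟨x', y'⟩.
Proof.
  intros h. destruct (lt_ex _ _ h) as [d hd]. unfold cpair. rewrite hd.
  replace ((x + y + d + 1) * (x + y + d + 1) + x') with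
    ((x + y) * (x + y) + x + (y + (x + y) + (x + y) * d + (x + y) * d
       + d * d + d + d + x') + 1) by ring.
  apply lt_add.
Qed.

Lemma pair_inj (x y x' y' : num) : ⟨x, y⟩ = ⟨x', y'⟩ -> x = x' /\ y = y'.
Proof.
  intros h. destruct (trichotomy (x + y) (x' + y')) as [h1|[h1|h1]].
  - apply pair_lt in h1. rewrite h in h1. contradiction (lt_irrefl _ h1).
  - unfold cpair in h. rewrite h1 in h. apply add_cancel_l in h. subst.
    apply add_cancel_l in h1. auto.
  - apply pair_lt in h1. rewrite h in h1. contradiction (lt_irrefl _ h1).
Qed.

(** * Least elements, bounding, and bounded comprehension *)

(** Without a least element, induction on [n] yields counterexamples to [R j] for all [j < n] below
    one common bound [b]. The common bound keeps the induction statement Sigma01. *)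
Lemma Pi1_least (R : num -> num -> Prop) :
  Delta0 2 (fun e => R (e O) (e 1%nat)) ->
  (exists n, forall y, R n y) ->
  exists n, (forall y, R n y) /\ forall m, m < n -> ~ forall y, R m y.
Proof.
  intros hR [n hn]. apply NNPP. intros hno.
  assert (H : forall n, exists b, forall j, j < n -> exists y, y < b /\ ~ R j y).
  { refine (Sigma1_ind _ _ _ _).
    (* [R] is abstract, so its instances in the formula are handled by the substitution lemma. *)
    - pose proof (fun k f g => Delta0_subst2 R k f g hR). delta0. apply H; delta0.
    - exists 0. intros j hj. contradiction (not_lt_0 _ hj).
    - intros k [b hb].
      (* Otherwise [k] would be least, as every smaller number has a counterexample by [hb]. *)
      assert (hk : ~ forall y, R k y).
      { intros hk. apply hno. exists k. split; auto. intros m hm hR'.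
        destruct (hb m hm) as (y & _ & hy). auto. }
      apply not_all_ex_not in hk. destruct hk as [y hy].
      exists (b + y + 1). intros j hj. apply lt_succ in hj.
      destruct hj as [hj| ->].
      + destruct (hb j hj) as (z & hz & hz'). exists z. split; auto.
        apply (lt_le_trans _ b); auto. rewrite <- (add_assoc b). apply le_add.
      + exists y. split; auto. rewrite (add_comm b). apply lt_add. }
  destruct (H (n + 1)) as [b hb].
  destruct (hb n (le_refl n)) as (y & _ & hy). auto.
Qed.

Lemma Delta0_least (P : num -> Prop) : Delta0 1 (fun e => P (e O)) ->
  (exists n, P n) -> exists n, P n /\ forall m, m < n -> ~ P m.
Proof.
  intros hP [n hn].
  destruct (Pi1_least (fun n _ => P n)) as (k & hk & hk').
  - apply (Delta0_subst1 P 2 (fun e => e O) hP). delta0.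
  - exists n. auto.
  - exists k. split; [apply (hk 0)|]. intros m hm h. apply (hk' m hm). auto.
Qed.

(** Sigma01 induction on [k], with the guard [j < n] making the step trivial once [k] has reached
    [n]. *)
Lemma Sigma1_bounding (R : num -> num -> Prop) :
  Delta0 2 (fun e => R (e O) (e 1%nat)) ->
  forall n, (forall j, j < n -> exists y, R j y) ->
  exists b, forall j, j < n -> exists y, y < b /\ R j y.
Proof.
  intros hR n h.
  destruct (Sigma1_ind (fun k b => forall j, j < k -> j < n ->
    exists y, y < b /\ R j y)) with n as [b hb].
  - pose proof (fun k f g => Delta0_subst2 R k f g hR) as H. delta0.
    apply H; delta0.
  - exists 0. intros j hj. contradiction (not_lt_0 _ hj).
  - intros k [b hb]. destruct (classic (k < n)) as [hk|hk].
    + destruct (h k hk) as [y hy].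
      exists (b + y + 1). intros j hj hj'. apply lt_succ in hj.
      destruct hj as [hj| ->].
      * destruct (hb j hj hj') as (z & hz & hz'). exists z. split; auto.
        apply (lt_le_trans _ b); auto. rewrite <- (add_assoc b). apply le_add.
      * exists y. split; auto. rewrite (add_comm b). apply lt_add.
    + exists b. intros j hj hj'. apply lt_succ in hj.
      destruct hj as [hj| ->]; auto. contradiction.
  - exists b. auto.
Qed.

(** * Divisibility and pairwise coprime moduli *)

Definition divides (p n : num) : Prop := exists q, n = q * p.

Lemma divides_mul (p a b : num) : divides p a -> divides p (a * b).
Proof. intros [q ->]. exists (q * b). ring. Qed.

Lemma divides_add_cancel (p a b : num) :
  divides p (a + b) -> divides p a -> divides p b.
Proof.
  intros [q hq] [r hr]. subst a.
  (* The quotients are compared in place of subtracting: [q < r] forces [b = 0], and otherwise [b]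
     is [q - r] times [p]. *)
  destruct (lt_or_le q r) as [h|h].
  - destruct (lt_ex _ _ h) as [d ->].
    assert (e : (d + 1) * p + b = 0).
    { apply (add_cancel_l _ _ (q * p)). rewrite add_0_r. etransitivity; [|exact hq]. ring. }
    apply add_eq_0 in e. destruct e as [_ ->]. exists 0. ring.
  - destruct (le_ex _ _ h) as [d ->]. exists d.
    apply (add_cancel_l _ _ (r * p)). etransitivity; [exact hq|]. ring.
Qed.

(** The factorial of [x] serves. Bounding the quotients by [m] makes the induction statement
    Sigma01. *)
Lemma common_multiple (x : num) :
  exists m, 0 < m /\ forall d, d < x -> divides (d + 1) m.
Proof.
  destruct (Sigma1_ind (fun x m => 0 < m /\
    forall d, d < x -> exists q, q < m + 1 /\ m = q * (d + 1))) with x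
    as (m & hm & h).
  - delta0.
  - exists 1. split.
    + rewrite <- (add_0_l 1). apply le_refl.
    + intros d hd. contradiction (not_lt_0 _ hd).
  - intros n (m & hm & h). exists (m * (n + 1)). split.
    + apply (lt_le_trans _ _ _ hm), le_mul_succ.
    + intros d hd. apply lt_succ in hd. destruct hd as [hd| ->].
      * destruct (h d hd) as (q & hq & e). exists (q * (n + 1)). split.
        -- rewrite e.
           replace (q * (d + 1) * (n + 1)) with (q * (n + 1) * (d + 1)) by ring.
           apply le_mul_succ.
        -- rewrite e. ring.
      * exists m. split; auto. apply le_mul_succ.
  - exists m. split; auto. intros d hd.
    destruct (h d hd) as (q & _ & e). exists q. exact e.
Qed.

(** The moduli of the Gödel beta function, in the form used by [fin_mem]. *)
Definition modulus (m u : num) : num := m * (u + 1) + 1.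

(** The modulus is 1 modulo [m], hence coprime to each divisor [d] of [m]. *)
Lemma modulus_divides_mul_factor (m u n d : num) : divides d m ->
  divides (modulus m u) (n * d) -> divides (modulus m u) n.
Proof.
  intros [g e] h. apply (divides_add_cancel _ (n * d * (g * (u + 1)))).
  - exists n. unfold modulus. rewrite e. ring.
  - apply divides_mul, h.
Qed.

(** For [u < v], [(v + 1) * modulus m u] exceeds [(u + 1) * modulus m v] by [v - u]. So the modulus
    of [u] divides [n * (v - u)], and [v - u] divides [m] and can be cancelled. The case [v < u] is
    symmetric. *)
Lemma modulus_coprime (m u v n x : num) :
  (forall d, d < x -> divides (d + 1) m) ->
  u < x -> v < x -> u <> v ->
  divides (modulus m u) (n * modulus m v) -> divides (modulus m u) n.
Proof.
  intros hm hu hv huv h. apply (divides_mul _ _ (u + 1)) in h.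
  destruct (trichotomy u v) as [hl|[hl|hl]]; [|contradiction|];
    destruct (lt_ex _ _ hl) as [d hd];
    apply (modulus_divides_mul_factor m u n (d + 1)).
  - apply hm. apply (lt_trans _ v); auto. rewrite hd, (add_comm u). apply lt_add.
  - revert h. apply divides_add_cancel. exists (n * (v + 1)).
    unfold modulus. rewrite hd. ring.
  - apply hm. apply (lt_trans _ u); auto. rewrite hd, (add_comm v). apply lt_add.
  - apply (divides_add_cancel _ (n * modulus m u * (v + 1))).
    + revert h. unfold modulus. rewrite hd. intros [q hq]. exists q.
      rewrite <- hq. ring.
    + exists (n * (v + 1)). ring.
Qed.

(* The code is the least positive common multiple of the moduli of the members
   of the class: a superfluous modulus could be divided out. *)
Lemma bounded_Sigma1_comprehension (Q : num -> num -> Prop) :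
  Delta0 2 (fun e => Q (e O) (e 1%nat)) ->
  forall x, exists m n, forall u, u < x ->
    (divides (modulus m u) n <-> exists y, Q u y).
Proof.
  intros hQ x. destruct (common_multiple x) as (m & hm0 & hm).
  (* Each modulus of some [u < x] is at most [m * (x + 1)], so [N] is a multiple of all of them and
     the minimization below has a candidate. *)
  destruct (common_multiple (m * (x + 1))) as (N & hN0 & hN).
  destruct (Pi1_least (fun n y => 0 < n /\ forall u, u < x -> Q u y ->
    exists q, q < n + 1 /\ n = q * modulus m u)) as (n & hn & hmin).
  { pose proof (fun k f g => Delta0_subst2 Q k f g hQ) as H.
    unfold modulus. delta0. apply H; delta0. }
  { exists N. intros y. split; auto. intros u hu _.
    destruct (hN (m * (u + 1))) as [q hq].
    - destruct (lt_ex _ _ hu) as [d ->]. destruct (lt_ex _ _ hm0) as [m' ->].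
      replace ((0 + m' + 1) * (u + d + 1 + 1)) with
        ((0 + m' + 1) * (u + 1) + (m' * (d + 1) + d) + 1) by ring.
      apply lt_add.
    - exists q. split; auto. rewrite hq. apply le_mul_succ. }
  exists m, n. intros u hu. split.
  - intros [q hq]. apply NNPP. intros hu'. destruct (hn 0) as [hn0 _].
    assert (hq0 : 0 < q).
    { destruct (zero_or_succ q) as [ ->|[k ->]]; [|apply zero_le].
      rewrite mul_0_l in hq. subst n. contradiction (lt_irrefl _ hn0). }
    apply (hmin q).
    (* The quotient [q] is smaller than [n] because [0 < m] makes the modulus at least 2. *)
    + destruct (lt_ex _ _ hm0) as [m' em]. destruct (lt_ex _ _ hq0) as [q' eq'].
      rewrite hq. unfold modulus.
      replace (q * (m * (u + 1) + 1)) with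
        (q + (m' + q' + q' * m' + q * m * u) + 1); [apply lt_add|].
      rewrite em, eq'. ring.
    + intros y. split; auto. intros v hv hvy.
      assert (hvu : v <> u) by (intros ->; apply hu'; exists y; auto).
      destruct (hn y) as [_ hny]. destruct (hny v hv hvy) as (r & _ & hr).
      destruct (modulus_coprime m v u q x hm hv hu hvu) as [t ht].
      { exists r. rewrite <- hq. exact hr. }
      exists t. split; auto. rewrite ht. apply le_mul_succ.
  - intros [y hy]. destruct (hn y) as [_ hny].
    destruct (hny u hu hy) as (q & _ & e). exists q. exact e.
Qed.

(** * Codes of finite sets *)

Lemma le_triple (k m n : num) : k <= ⟨k, ⟨m, n⟩⟩ /\ m <= ⟨k, ⟨m, n⟩⟩ /\
  n <= ⟨k, ⟨m, n⟩⟩.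
Proof.
  repeat split.
  - apply le_pair_l.
  - apply (le_trans _ _ _ (le_pair_l m n)), le_pair_r.
  - apply (le_trans _ _ _ (le_pair_r m n)), le_pair_r.
Qed.

Lemma fin_mem_lt (x c : num) : fin_mem x c -> x < c.
Proof.
  intros (k & m & n & -> & h & _). apply (lt_le_trans _ _ _ h), le_pair_l.
Qed.

Lemma fin_mem_triple (x k m n : num) :
  fin_mem x ⟨k, ⟨m, n⟩⟩ <-> x < k /\ divides (modulus m x) n.
Proof.
  split.
  - intros (k' & m' & n' & e & h & h').
    apply pair_inj in e. destruct e as [<- e].
    apply pair_inj in e. destruct e as [<- <-]. auto.
  - intros [h h']. exists k, m, n. auto.
Qed.

(** Components of a pair are at most the pair, and a quotient by a modulus is at most the dividend,
    so every quantifier can be bounded by the code. *)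
Lemma Delta0_fin_mem k f g : is_term k f -> is_term k g ->
  Delta0 k (fun e => fin_mem (M := M) (f e) (g e)).
Proof.
  apply Delta0_subst2.
  apply Delta0_ext with (fun e => exists k, k < e 1%nat + 1 /\
    exists m, m < e 1%nat + 1 /\ exists n, n < e 1%nat + 1 /\
    (e 1%nat = ⟨k, ⟨m, n⟩⟩ /\ e O < k /\
     exists q, q < n + 1 /\ n = q * (m * (e O + 1) + 1))); [|delta0].
  intros e. split.
  - intros (a & _ & m & _ & n & _ & h & h' & q & _ & h'').
    exists a, m, n. eauto.
  - intros (a & m & n & h & h' & q & hq).
    destruct (le_triple a m n) as (h1 & h2 & h3).
    exists a. rewrite h. split; auto. exists m. split; auto. exists n.
    split; auto. split; auto. split; auto. exists q. split; auto.
    rewrite hq at 1. apply le_mul_succ.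
Qed.

Lemma Delta0_fin_rep k f : is_term k f ->
  Delta0 k (fun e => fin_rep (M := M) (f e)).
Proof.
  apply Delta0_subst1.
  apply Delta0_ext with (fun e => exists k, k < e O + 1 /\
    exists m, m < e O + 1 /\ exists n, n < e O + 1 /\
    e O = ⟨k, ⟨m, n⟩⟩); [|delta0].
  intros e. split.
  - intros (a & _ & m & _ & n & _ & h). exists a, m, n. auto.
  - intros (a & m & n & h). destruct (le_triple a m n) as (h1 & h2 & h3).
    exists a. rewrite h. split; auto. exists m. split; auto. exists n. auto.
Qed.

(** Members lie below their code, so testing [x] below the sum of the codes suffices. *)
Lemma Delta0_same_members k f g : is_term k f -> is_term k g ->
  Delta0 k (fun e => forall x, fin_mem (M := M) x (f e) <-> fin_mem x (g e)).
Proof.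
  apply (Delta0_subst2 (fun a b => forall x, fin_mem x a <-> fin_mem x b)).
  apply Delta0_ext with (fun e => forall x, x < e O + e 1%nat ->
    (fin_mem x (e O) <-> fin_mem x (e 1%nat))).
  - intros e. split; auto. intros h x.
    split; intros hx; apply h; auto; apply fin_mem_lt in hx.
    + apply (lt_le_trans _ _ _ hx), le_add.
    + apply (lt_le_trans _ _ _ hx), le_add_l.
  - delta0; apply Delta0_fin_mem; delta0.
Qed.

Lemma Delta0_fin_code k f : is_term k f ->
  Delta0 k (fun e => fin_code (M := M) (f e)).
Proof.
  apply Delta0_subst1. unfold fin_code. delta0; [apply Delta0_fin_rep; delta0..|].
  apply Delta0_same_members; delta0.
Qed.

Lemma fin_code_inj (a b : num) : fin_code a -> fin_code b ->
  (forall x, fin_mem x a <-> fin_mem x b) -> a = b.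
Proof.
  intros [ra ha] [rb hb] h. destruct (trichotomy a b) as [hl|[hl|hl]]; auto.
  - contradiction (hb a hl ra).
  - contradiction (ha b hl rb). intros x. rewrite h. tauto.
Qed.

Lemma fin_code_of_Sigma1 (Q : num -> num -> Prop) :
  Delta0 2 (fun e => Q (e O) (e 1%nat)) ->
  forall x, exists a, fin_code a /\
    forall u, fin_mem u a <-> u < x /\ exists y, Q u y.
Proof.
  intros hQ x. destruct (bounded_Sigma1_comprehension Q hQ x) as (m & n & h).
  destruct (Delta0_least (fun d => fin_rep d /\
    forall u, fin_mem u d <-> fin_mem u ⟨x, ⟨m, n⟩⟩)) as (a & [ha ha'] & hmin).
  - apply Delta0_and; [apply Delta0_fin_rep; delta0|].
    apply Delta0_same_members; delta0.
  - exists ⟨x, ⟨m, n⟩⟩. split; [|tauto]. exists x, m, n. reflexivity.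
  - exists a. split.
    + split; auto. intros d hd hr hs. apply (hmin d hd). split; auto.
      intros u. rewrite hs. apply ha'.
    + intros u. rewrite ha', fin_mem_triple.
      split; intros [hu hu']; split; auto; apply (h u hu); auto.
Qed.

Lemma initial_segment_code (A : Sets M) (x : num) :
  exists a, fin_code a /\ forall u, fin_mem u a <-> u < x /\ u ∈ A.
Proof.
  destruct (fin_code_of_Sigma1 (fun u _ => u ∈ A)) with x as (a & ha & h).
  - delta0.
  - exists a. split; auto. intros u. rewrite h.
    split; intros [h1 h2]; split; auto; [destruct h2; auto | exists 0; auto].
Qed.

(** The finite set at stage [n] consists of the members of [A] below [n]; uniqueness of codes makes
    this a function. *)
Lemma enumerate_set (A : Sets M) : exists B : Sets M, is_enumerable B /\
  forall x, enum_mem x B <-> x ∈ A.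
Proof.
  destruct (Delta0_comprehension (fun p => exists n, n < p + 1 /\
    exists a, a < p + 1 /\ (p = ⟨n, a⟩ /\ fin_code a /\
      (forall x, x < a -> fin_mem x a -> x < n /\ x ∈ A) /\
      (forall x, x < n -> x ∈ A -> fin_mem x a)))) as [B hB].
  { delta0; try (apply Delta0_fin_mem; delta0); apply Delta0_fin_code; delta0. }
  assert (H : forall n a, ⟨n, a⟩ ∈ B <-> fin_code a /\
    forall x, fin_mem x a <-> x < n /\ x ∈ A).
  { intros n a. rewrite hB. split.
    - intros (n' & _ & a' & _ & e & ha & h1 & h2).
      apply pair_inj in e. destruct e as [<- <-]. split; auto.
      intros x. split.
      + intros hx. apply h1; auto. apply fin_mem_lt, hx.
      + intros []. auto.
    - intros [ha h]. exists n. split; [apply le_pair_l|].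
      exists a. split; [apply le_pair_r|]. split; auto. split; auto.
      split; [|intros; apply h; auto]. intros x _ hx. apply h, hx. }
  exists B. split; [split; [split; [|split]|]|].
  - intros p hp. apply hB in hp.
    destruct hp as (n & _ & a & _ & -> & ha & _). exists n, a. auto.
  - intros n _. destruct (initial_segment_code A n) as [a ha]. exists a.
    apply H, ha.
  - intros n a b ha hb. apply H in ha, hb. destruct ha as [ha ha'], hb as [hb hb'].
    apply fin_code_inj; auto. intros x. rewrite ha', hb'. tauto.
  - intros m n a b hmn ha hb x. apply H in ha, hb.
    destruct ha as [ha ha'], hb as [hb hb'].
    rewrite ha', hb'. intros [h1 h2]. split; auto. apply (lt_trans _ m); auto.
  - intros x. split.
    + intros (n & a & h & hx). apply H in h. apply h, hx.
    + intros hx. destruct (initial_segment_code A (x + 1)) as [a ha].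
      exists (x + 1), a. split; [apply H, ha|]. apply ha. split; auto.
      apply le_refl.
Qed.

(** * From Sigma01 to arithmetical comprehension *)

Definition Sigma1_comprehension : Prop :=
  forall Q : num -> num -> Prop, Delta0 2 (fun e => Q (e O) (e 1%nat)) ->
  exists X, forall n, n ∈ X <-> exists y, Q n y.

(* Pairing reduces any number of free variables to one. *)
Lemma Delta0_ex (h : Sigma1_comprehension) k : forall (Q : env -> num -> Prop),
  Delta0 (S k) (fun e => Q (fun n => e (S n)) (e O)) ->
  Delta0 k (fun e => exists x, Q e x).
Proof.
  destruct k as [|k].
  (* With no free variable the statement is a fixed proposition, since by locality the environment
     may be taken to be zero. *)
  - intros Q hQ. apply Delta0_ext with (fun _ => exists x, Q (fun _ => 0) x);
      [|delta0].
    intros e. split; intros [x hx]; exists x; revert hx.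
    + apply (Delta0_local 1 _ hQ (scons x (fun _ => 0)) (scons x e)).
      intros [|i] hi; [reflexivity|lia].
    + apply (Delta0_local 1 _ hQ (scons x e) (scons x (fun _ => 0))).
      intros [|i] hi; [reflexivity|lia].
  - induction k as [|k IH]; intros Q hQ.
    + destruct (h (fun n y => Q (fun _ => n) y)) as [X hX].
      { apply (Delta0_subst 2 2 _
          (fun i e => match i with O => e 1%nat | _ => e O end) hQ).
        intros [|i] hi; delta0. }
      apply Delta0_ext with (fun e => e O ∈ X); [|delta0].
      intros e. rewrite hX. split; intros [x hx]; exists x; revert hx.
      * apply (Delta0_local 2 _ hQ (scons x (fun _ => e O)) (scons x e)).
        intros [|[|i]] hi; [reflexivity..|lia].
      * apply (Delta0_local 2 _ hQ (scons x e) (scons x (fun _ => e O))).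
        intros [|[|i]] hi; [reflexivity..|lia].
    (* Variable 0 now holds the pair of the first two variables, decoded by bounded quantifiers. *)
    + specialize (IH (fun e x => exists a, a < e O + 1 /\ exists b, b < e O + 1 /\
        (e O = ⟨a, b⟩ /\ Q (scons a (scons b (fun i => e (S i)))) x))).
      apply Delta0_ext with (fun e => exists x,
        exists a, a < ⟨e O, e 1%nat⟩ + 1 /\ exists b, b < ⟨e O, e 1%nat⟩ + 1 /\
        (⟨e O, e 1%nat⟩ = ⟨a, b⟩ /\
         Q (scons a (scons b (fun i => e (S (S i))))) x)).
      { assert (hl : forall e x, Q (scons (e O) (scons (e 1%nat)
            (fun i => e (S (S i))))) x <-> Q e x).
        { intros e x. split.
          - apply (Delta0_local _ _ hQ (scons x (scons (e O) (scons (e 1%nat)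
              (fun i => e (S (S i)))))) (scons x e)).
            intros [|[|[|i]]] hi; reflexivity.
          - apply (Delta0_local _ _ hQ (scons x e) (scons x (scons (e O)
              (scons (e 1%nat) (fun i => e (S (S i))))))).
            intros [|[|[|i]]] hi; reflexivity. }
        intros e. split.
        - intros (x & a & _ & b & _ & e' & hx). exists x.
          apply pair_inj in e'. destruct e' as [<- <-]. apply hl, hx.
        - intros [x hx]. exists x, (e O). split; [apply le_pair_l|].
          exists (e 1%nat). split; [apply le_pair_r|]. split; auto.
          apply hl, hx. }
      refine (Delta0_subst _ (S k) _ (fun i e => match i with
        | O => ⟨e O, e 1%nat⟩ | S j => e (S (S j)) end) (IH _) _).
      2: { intros [|i] hi; delta0. }
      apply Delta0_ex_lt; [delta0|]. apply Delta0_ex_lt; [delta0|].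
      apply Delta0_and; [delta0|].
      (* Here index 0 is [b], 1 is [a], 2 is [x] and 3 is the pair, which is skipped. *)
      apply (Delta0_subst _ _ _ (fun i e => match i with
        | O => e 2%nat | 1%nat => e 1%nat | 2%nat => e O
        | S (S (S j)) => e (S (S (S (S j)))) end) hQ).
      intros [|[|[|i]]] hi; delta0.
Qed.

Lemma Delta0_all (h : Sigma1_comprehension) k (Q : env -> num -> Prop) :
  Delta0 (S k) (fun e => Q (fun n => e (S n)) (e O)) ->
  Delta0 k (fun e => forall x, Q e x).
Proof.
  intros hQ. apply Delta0_ext with (fun e => ~ exists x, ~ Q e x).
  - intros e. split; [|firstorder]. intros hn x. apply NNPP. eauto.
  - apply Delta0_not, (Delta0_ex h k (fun e x => ~ Q e x)), Delta0_not, hQ.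
Qed.

(** Each unbounded quantifier is absorbed into a set parameter; [k] varies because a quantifier adds
    a variable. *)
Lemma Delta0_sat (h : Sigma1_comprehension) phi : forall k c E,
  Delta0 k (fun e => sat (M := M) (glue k e c) E phi).
Proof.
  assert (ht : forall k c t, is_term k (fun e : env => teval (glue k e c) t)).
  { intros k c t. exists c, t. reflexivity. }
  induction phi; intros k c E; simpl.
  - apply Delta0_eq; apply ht.
  - apply Delta0_lt; apply ht.
  - apply Delta0_mem; apply ht.
  - apply Delta0_not, IHphi.
  - apply Delta0_and; auto.
  - apply Delta0_or; auto.
  - apply Delta0_imp; auto.
  - apply Delta0_all_lt; [apply ht | apply (IHphi (S k))].
  - apply Delta0_ex_lt; [apply ht | apply (IHphi (S k))].
  - apply (Delta0_all h k (fun e x => sat (scons x (glue k e c)) E phi)).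
    apply (IHphi (S k)).
  - apply (Delta0_ex h k (fun e x => sat (scons x (glue k e c)) E phi)).
    apply (IHphi (S k)).
Qed.

Lemma ACA_iff_Sigma1_comprehension :
  arithmetical_comprehension M <-> Sigma1_comprehension.
Proof.
  split.
  - intros h Q hQ.
    pose proof (Delta0_subst2 Q 2 (fun e => e 1%nat) (fun e => e O) hQ) as hQ'.
    destruct hQ' as (c & E & t & hb & ht); [delta0..|].
    destruct (h (fEx t) c E) as [X hX]. exists X. intros n. rewrite hX. simpl.
    split; intros [y hy]; exists y; apply (ht (scons y (scons n c))), hy.
  - intros h phi c E. apply Delta0_comprehension, (Delta0_sat h phi 1 c E).
Qed.

(** * Sequential compactness *)

Lemma accumulation_points_of_ACA :
  arithmetical_comprehension M -> compact_sequentially_compact M.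
Proof.
  intros h S hS hcomp s hs. apply ACA_iff_Sigma1_comprehension in h.
  pose proof (fun k Q => Delta0_ex h k Q) as hex.
  pose proof (fun k Q => Delta0_all h k Q) as hall.
  apply NNPP. intros hno.
  (* [G] holds the indices whose neighbourhood contains only finitely many terms of [s]. It covers
     the space when no accumulation point exists. *)
  destruct (Delta0_comprehension (fun i => i ∈ idx S /\ exists b,
    forall n y, ⟨n, y⟩ ∈ s -> ⟨y, i⟩ ∈ nbhs S -> n < b)) as [G hG].
  { apply Delta0_and; [delta0|]. apply Delta0_ex; auto.
    do 2 (apply Delta0_all; auto). delta0. }
  destruct (enumerate_set G) as (A & hA & hAG).
  assert (hGi : forall i, i ∈ G -> i ∈ idx S) by (intros i hi; apply hG, hi).
  destruct (hcomp A hA) as (a & _ & haA & hcov).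
  - intros i hi. apply hGi, hAG, hi.
  - intros x. split.
    + intros hx. apply NNPP. intros hnx. apply hno. exists x. split; auto.
      intros i hi hix [b hb]. apply hnx. exists i. split; auto. apply hAG, hG.
      split; auto. exists b. intros n y hny hyi. apply hb. exists y. auto.
    + intros (i & hi & hix). apply hAG, hGi in hi. destruct hS as [hU _].
      apply (hU i x hi hix).
  (* Members of [a] lie below the code [a], so bounding ranges over all [i < a]; nonmembers receive
     the bound 0. *)
  - destruct (Sigma1_bounding (fun i b => fin_mem i a ->
      forall n y, ⟨n, y⟩ ∈ s -> ⟨y, i⟩ ∈ nbhs S -> n < b)) with a as [B hB].
    + apply Delta0_imp; [apply Delta0_fin_mem; delta0|].
      do 2 (apply Delta0_all; auto). delta0.
    + intros i _. destruct (classic (fin_mem i a)) as [hi|hi].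
      * apply haA, hAG, hG in hi. destruct hi as [_ [b hb]]. exists b. auto.
      * exists 0. intros. contradiction.
    (* The term with index [B] lies in some [U_i] of the subcover, which allows only indices below
       some [b < B]. *)
    + destruct hs as (hs1 & hs2 & _). destruct (hs2 B I) as [y hy].
      assert (hyS : y ∈ pts S).
      { destruct (hs1 _ hy) as (x & z & e & _ & hz).
        apply pair_inj in e. destruct e as [_ ->]. exact hz. }
      apply hcov in hyS. destruct hyS as (i & hi & hiy).
      destruct (hB i (fin_mem_lt _ _ hi)) as (b & hbB & hb).
      apply (lt_irrefl B). apply (lt_trans _ b); auto. eapply hb; eauto.
Qed.

Lemma finite_of_sequentially_compact (S : space M) :
  discrete S -> sequentially_compact S -> finite_space S.
Proof.
  intros hd hs. apply NNPP. intros hinf.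
  assert (hunb : forall n, exists y, y ∈ pts S /\ n <= y).
  { intros n. apply NNPP. intros hn. apply hinf. exists n. intros x hx.
    destruct (lt_or_le x n) as [h|h]; auto. contradiction hn. eauto. }
  destruct (Delta0_comprehension (fun p => exists n, n < p + 1 /\
    exists y, y < p + 1 /\ (p = ⟨n, y⟩ /\ (y ∈ pts S /\ n <= y) /\
      forall z, z < y -> ~ (z ∈ pts S /\ n <= z)))) as [s hsP]; [delta0|].
  assert (H : forall n y, ⟨n, y⟩ ∈ s <-> (y ∈ pts S /\ n <= y) /\
      forall z, z < y -> ~ (z ∈ pts S /\ n <= z)).
  { intros n y. rewrite hsP. split.
    - intros (n' & _ & y' & _ & e & h).
      apply pair_inj in e. destruct e as [<- <-]. exact h.
    - intros h. exists n. split; [apply le_pair_l|].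
      exists y. split; [apply le_pair_r|]. auto. }
  destruct (hs s) as [x [hx hacc]].
  - split; [|split].
    + intros p hp. apply hsP in hp.
      destruct hp as (n & _ & y & _ & -> & [hy _] & _). exists n, y. auto.
    + intros n _.
      destruct (Delta0_least (fun y => y ∈ pts S /\ n <= y)) as [y hy];
        [delta0 | apply hunb |]. exists y. apply H, hy.
    + intros n y z hy hz. apply H in hy, hz.
      destruct hy as [hy hy'], hz as [hz hz'].
      destruct (trichotomy y z) as [h|[h|h]]; auto.
      * contradiction (hz' y h).
      * contradiction (hy' z h).
  - destruct (hd x hx) as (i & hi & hUi).
    apply (hacc i hi); [apply hUi; reflexivity|].
    (* A term equal to [x] has index at most [x], because term [n] is at least [n]. *)
    exists (x + 1). intros n (y & hy & hyi). apply hUi in hyi. subst y.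
    apply H in hy. apply hy.
Qed.

(** * An infinite effectively compact discrete space *)

Section StageSpace.
Context (Q : num -> num -> Prop) (hQ : Delta0 2 (fun e => Q (e O) (e 1%nat))).

Definition new_below (z t x : num) : Prop :=
  exists u, u < z /\ (exists r, r < x /\ Q u r) /\ forall r, r < t -> ~ Q u r.

Definition stage_nbhd (i x : num) : Prop :=
  exists z t, i = ⟨z, t⟩ /\ (x = z \/ new_below z t x).

Lemma stage_nbhd_pair z t x : stage_nbhd ⟨z, t⟩ x <-> x = z \/ new_below z t x.
Proof.
  split; [|exists z, t; auto]. intros (z' & t' & e & h).
  apply pair_inj in e. destruct e as [<- <-]. exact h.
Qed.

(** The noncentral part of a neighbourhood is thus upward closed, and it shrinks as the stage [t]
    grows. *)
Lemma new_below_mono z t t' x y :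
  x <= y -> t' <= t -> new_below z t x -> new_below z t' y.
Proof.
  intros hx ht (u & hu & (r & hr & hur) & h). exists u. split; auto. split.
  - exists r. split; auto. apply (lt_le_trans _ x); auto.
  - intros r' hr'. apply h. apply (lt_le_trans _ t'); auto.
Qed.

(** A witness below [x] cannot be below [t]. Noncentral points thus lie beyond the stage. *)
Lemma new_below_lt z t x : new_below z t x -> t < x.
Proof.
  intros (u & hu & (r & hr & hur) & h). destruct (lt_or_le r t) as [h'|h'].
  - contradiction (h r h').
  - apply (le_lt_trans _ r); auto.
Qed.

(** Bounding needs a witness for every [u < z], but some [u] may have none. A code for the class
    below [z] turns membership into a bounded premise, under which a default witness is allowed. *)
Lemma stage_exists z : exists t, forall x, ~ new_below z t x.
Proof.
  destruct (bounded_Sigma1_comprehension Q hQ z) as (m & n & h).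
  destruct (Sigma1_bounding (fun u r => (exists q, q < n + 1 /\
    n = q * modulus m u) -> Q u r)) with z as [t ht].
  - pose proof (fun k f g => Delta0_subst2 Q k f g hQ) as H. unfold modulus.
    delta0.
  - intros u hu. destruct (classic (exists r, Q u r)) as [[r hr]|hr].
    + exists r. auto.
    + exists 0. intros (q & _ & e). contradiction hr. apply (h u hu).
      exists q. exact e.
  - exists t. intros x (u & hu & (r & _ & hr) & hno).
    destruct (ht u hu) as (r' & hr' & hQr').
    apply (hno r' hr'), hQr'.
    destruct (proj2 (h u hu)) as [q e]; [exists r; exact hr|].
    exists q. split; auto. rewrite e. apply le_mul_succ.
Qed.

Lemma stage_space_exists : exists S : space M,
  (forall x, x ∈ pts S) /\ (forall x, x ∈ idx S) /\
  (forall i x, U S i x <-> stage_nbhd i x) /\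
  (forall p, p ∈ sel S <-> exists x i j,
    p = ⟨⟨x, ⟨i, j⟩⟩, ⟨x, x + i + j⟩⟩).
Proof.
  pose proof (fun k f g => Delta0_subst2 Q k f g hQ) as H.
  destruct (Delta0_comprehension (fun _ => True)) as [X hX]; [delta0|].
  destruct (Delta0_comprehension (fun p => exists x, x < p + 1 /\
    exists z, z < p + 1 /\ exists t, t < p + 1 /\ (p = ⟨x, ⟨z, t⟩⟩ /\
    (x = z \/ exists u, u < z /\ (exists r, r < x /\ Q u r) /\
      forall r, r < t -> ~ Q u r)))) as [N hN].
  { delta0; apply H; delta0. }
  (* The selected neighbourhood of [x] has center [x] and stage [x + i + j], which is at least [x]
     and the stages coded in [i] and [j]. *)
  destruct (Delta0_comprehension (fun p => exists x, x < p + 1 /\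
    exists i, i < p + 1 /\ exists j, j < p + 1 /\
    p = ⟨⟨x, ⟨i, j⟩⟩, ⟨x, x + i + j⟩⟩)) as [K hK]; [delta0|].
  exists {| pts := X; idx := X; nbhs := N; sel := K |}. simpl.
  split; [intros x; apply hX, I|]. split; [intros x; apply hX, I|]. split.
  - intros i x. unfold U. simpl. rewrite hN. split.
    + intros (x' & _ & z & _ & t & _ & e & h).
      apply pair_inj in e. destruct e as [<- ->]. exists z, t. auto.
    + intros (z & t & -> & h). destruct (le_triple x z t) as (h1 & h2 & h3).
      exists x. split; auto. exists z. split; auto. exists t. auto.
  - intros p. rewrite hK. split.
    + intros (x & _ & i & _ & j & _ & e). exists x, i, j. exact e.
    + intros (x & i & j & ->). destruct (le_triple x i j) as (h1 & h2 & h3).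
      pose proof (le_pair_l ⟨x, ⟨i, j⟩⟩ ⟨x, x + i + j⟩) as h.
      exists x. split; [apply (le_trans _ _ _ h1 h)|].
      exists i. split; [apply (le_trans _ _ _ h2 h)|].
      exists j. split; [apply (le_trans _ _ _ h3 h)|]. reflexivity.
Qed.

Context (S : space M) (hpts : forall x, x ∈ pts S) (hidx : forall x, x ∈ idx S)
  (hU : forall i x, U S i x <-> stage_nbhd i x)
  (hsel : forall p, p ∈ sel S <-> exists x i j,
     p = ⟨⟨x, ⟨i, j⟩⟩, ⟨x, x + i + j⟩⟩).

(** If [x] is the center of [U_i], raising the stage only removes points. If it is not, [U_i]
    contains everything from [x] on, and the points of the new neighbourhood other than [x] lie
    beyond [s]. *)
Lemma stage_nbhd_shrink x i s y : stage_nbhd i x -> x <= s -> i <= s ->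
  stage_nbhd ⟨x, s⟩ y -> stage_nbhd i y.
Proof.
  intros (z & t & -> & h) hx hi hy. apply stage_nbhd_pair in hy.
  apply stage_nbhd_pair. destruct hy as [ ->|hy]; auto. right. destruct h as [<-|h].
  - revert hy. apply new_below_mono; [apply le_refl|].
    apply (le_trans _ _ _ (le_pair_r x t)); auto.
  - revert h. apply new_below_mono; [|apply le_refl].
    apply lt_le. apply (le_lt_trans _ s); auto. apply (new_below_lt _ _ _ hy).
Qed.

Lemma stage_space_csc : is_csc_space S.
Proof.
  split; [auto|]. split; [split; [|split]|split].
  - intros p hp. apply hsel in hp. destruct hp as (x & i & j & ->).
    exists ⟨x, ⟨i, j⟩⟩, ⟨x, x + i + j⟩. split; auto. split; auto.
    exists x, i, j. auto.
  - intros p (x & i & j & -> & _). exists ⟨x, x + i + j⟩. apply hsel.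
    exists x, i, j. reflexivity.
  - intros p y z hy hz. apply hsel in hy, hz.
    destruct hy as (x & i & j & hy), hz as (x' & i' & j' & hz).
    apply pair_inj in hy, hz. destruct hy as [-> ->], hz as [hz ->].
    apply pair_inj in hz. destruct hz as [<- hz].
    apply pair_inj in hz. destruct hz as [<- <-]. reflexivity.
  - intros x _. exists ⟨x, 0⟩. split; auto. apply hU, stage_nbhd_pair. auto.
  - intros x i j l _ _ _ hl hi hj. apply hsel in hl.
    destruct hl as (x' & i' & j' & e). apply pair_inj in e.
    destruct e as [e ->]. apply pair_inj in e. destruct e as [<- e].
    apply pair_inj in e. destruct e as [<- <-]. split.
    + apply hU, stage_nbhd_pair. auto.
    + intros y hy. rewrite !hU in *.
      assert (hx : x <= x + i + j)
        by (rewrite <- (add_assoc x); apply le_add).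
      split; revert hy; apply stage_nbhd_shrink; auto.
      * apply (le_trans _ (x + i)); [apply le_add_l | apply le_add].
      * apply le_add_l.
Qed.

Lemma stage_space_discrete : discrete S.
Proof.
  intros x _. destruct (stage_exists x) as [t ht]. exists ⟨x, t⟩.
  split; auto. intros y. rewrite hU, stage_nbhd_pair.
  split; auto. intros [h|h]; auto. contradiction (ht y h).
Qed.

(* If a member of [a] covers the point [a], then not as its center, which is
   smaller; hence it covers all later points too. *)
Lemma stage_space_cover_relation : has_finite_cover_relation S.
Proof.
  destruct (Delta0_comprehension (fun a => fin_code a /\ forall y, y < a + 1 ->
    exists i, i < a /\ (fin_mem i a /\ ⟨y, i⟩ ∈ nbhs S))) as [C hC].
  { delta0; [apply Delta0_fin_code | apply Delta0_fin_mem]; delta0. }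
  exists C. split.
  - intros a ha. apply hC in ha. split; [apply ha | auto].
  - intros a [ha _]. rewrite hC. split.
    + intros [_ h] x. split; auto. intros _.
      destruct (lt_or_le x (a + 1)) as [hx|hx].
      * destruct (h x hx) as (i & _ & hi). exists i. exact hi.
      * destruct (h a (le_refl a)) as (i & hia & hi & hUi). exists i. split; auto.
        apply hU in hUi. apply hU. destruct hUi as (z & t & -> & hz).
        apply stage_nbhd_pair. right. destruct hz as [<-|hz].
        -- contradiction (not_le_lt _ _ (le_pair_l a t) hia).
        -- revert hz. apply new_below_mono; [|apply le_refl].
           apply (le_trans _ (a + 1)); auto. apply lt_le, le_refl.
    + intros h. split; auto. intros y _. destruct (proj1 (h y) (hpts y))
        as (i & hi & hiy). exists i. split; [apply fin_mem_lt, hi|]. auto.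
Qed.

(* Either some member of the cover has a noncentral point, hence contains all
   later ones, or every member is a singleton [{z}] whose stage decides which
   [u < z] are in the class. *)
Lemma stage_space_compact :
  ~ (exists X, forall n, n ∈ X <-> exists y, Q n y) -> compact S.
Proof.
  intros hno A [[hA1 [hA2 hA3]] hA4] _ hcov.
  assert (hle : forall m n a b x, m <= n -> ⟨m, a⟩ ∈ A -> ⟨n, b⟩ ∈ A ->
    fin_mem x a -> fin_mem x b).
  { intros m n a b x hmn ha hb hx. apply lt_succ in hmn.
    destruct hmn as [hmn| ->]; [apply (hA4 m n a b hmn ha hb x hx)|].
    rewrite <- (hA3 _ _ _ ha hb). exact hx. }
  destruct (classic (exists z t y, enum_mem ⟨z, t⟩ A /\ new_below z t y))
    as [(z & t & y & (n0 & a0 & hn0 & hzt) & hy)|hsing].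
  (* [U_⟨z, t⟩] contains all points from [y] on; the points below [y] are covered by some common
     stage. *)
  - destruct (Sigma1_bounding (fun x w => exists n, n < w /\ exists a, a < w /\
      exists i, i < w /\ (⟨n, a⟩ ∈ A /\ fin_mem i a /\ ⟨x, i⟩ ∈ nbhs S)))
      with y as [b hb].
    + delta0. apply Delta0_fin_mem; delta0.
    + intros x _. destruct (proj1 (hcov x) (hpts x)) as (i & (n & a & hna & hia) & hx).
      exists (n + a + i + 1). exists n. split.
      { replace (n + a + i + 1) with (n + (a + i) + 1) by ring. apply lt_add. }
      exists a. split.
      { replace (n + a + i + 1) with (a + (n + i) + 1) by ring. apply lt_add. }
      exists i. split; [apply le_add_l|]. auto.
    (* By stage [n0 + b] both [⟨z, t⟩] and indices covering all [x < y] have been enumerated. *)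
    + destruct (hA2 (n0 + b) Logic.I) as [c hc].
      exists c. split.
      { destruct (hA1 _ hc) as (n & d & e & _ & hd). apply pair_inj in e.
        destruct e as [_ ->]. exact hd. }
      split; [intros i hi; exists (n0 + b), c; auto|].
      intros x. split; auto. intros _. destruct (lt_or_le x y) as [hx|hx].
      * destruct (hb x hx) as (w & hw & n & hn & a & _ & i & _ & hna & hia & hi).
        exists i. split; auto. apply (hle n (n0 + b) a c i); auto.
        apply lt_le. apply (lt_trans _ w); auto.
        apply (lt_le_trans _ b); auto. apply le_add_l.
      * exists ⟨z, t⟩. split.
        { apply (hle n0 (n0 + b) a0 c); auto. apply le_add. }
        apply hU, stage_nbhd_pair. right. revert hy.
        apply new_below_mono; auto. apply le_refl.
  - contradiction hno.
    (* The neighbourhood covering the point [u + 1] must be centered there, and [u] lies below this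
       center. If [u] had a witness but none below [t], there would be a noncentral point. *)
    assert (hdec : forall u, exists t, enum_mem ⟨u + 1, t⟩ A /\
      ((exists r, Q u r) <-> exists r, r < t /\ Q u r)).
    { intros u. destruct (proj1 (hcov (u + 1)) (hpts _)) as (i & hi & hUi).
      apply hU in hUi. destruct hUi as (z & t & -> & [<-|hz]).
      - exists t. split; auto. split; [|intros (r & _ & hr); eauto].
        intros [r hr]. apply NNPP. intros ht. apply hsing.
        exists (u + 1), t, (r + 1). split; auto. exists u.
        split; [apply le_refl|]. split; [exists r; split; auto; apply le_refl|].
        intros r' hr' hQr'. apply ht. eauto.
      - contradiction hsing. eauto. }
    (* One bound [w] for the stage, the code and [t] leaves a single unbounded quantifier. *)
    assert (hsome : forall (P : num -> num -> Prop) u,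
      (exists w, exists n, n < w /\ exists a, a < w /\ exists t, t < w /\
        (⟨n, a⟩ ∈ A /\ fin_mem ⟨u + 1, t⟩ a /\ P u t)) <->
      exists t, enum_mem ⟨u + 1, t⟩ A /\ P u t).
    { intros P u. split.
      - intros (w & n & _ & a & _ & t & _ & hna & ha & hP). exists t.
        split; auto. exists n, a. auto.
      - intros (t & (n & a & hna & ha) & hP). exists (n + a + t + 1).
        exists n. split.
        { replace (n + a + t + 1) with (n + (a + t) + 1) by ring. apply lt_add. }
        exists a. split.
        { replace (n + a + t + 1) with (a + (n + t) + 1) by ring. apply lt_add. }
        exists t. split; [apply le_add_l|]. auto. }
    pose proof (fun k f g => Delta0_subst2 Q k f g hQ) as HQ.
    (* Membership of [u] is read off from any enumerated [⟨u + 1, t⟩]: some one shows a witness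
       below [t], or equivalently none fails to. *)
    destruct (Delta1_comprehension
      (fun u w => exists n, n < w /\ exists a, a < w /\ exists t, t < w /\
        (⟨n, a⟩ ∈ A /\ fin_mem ⟨u + 1, t⟩ a /\ exists r, r < t /\ Q u r))
      (fun u w => ~ exists n, n < w /\ exists a, a < w /\ exists t, t < w /\
        (⟨n, a⟩ ∈ A /\ fin_mem ⟨u + 1, t⟩ a /\ ~ exists r, r < t /\ Q u r)))
      as [X hX].
    + delta0; [apply Delta0_fin_mem | apply HQ]; delta0.
    + delta0; [apply Delta0_fin_mem | apply HQ]; delta0.
    + intros u. rewrite (hsome (fun u t => exists r, r < t /\ Q u r)). split.
      * intros (t & _ & r & _ & hr) w hw.
        destruct (proj1 (hsome (fun u t => ~ exists r, r < t /\ Q u r) u))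
          as (t' & ht' & hno'); [exists w; exact hw|].
        (* A witness [r] missed by the stage [t'] would make [r + 1] a noncentral point. *)
        apply hno'. apply NNPP. intros _. apply hsing.
        exists (u + 1), t', (r + 1). split; auto. exists u.
        split; [apply le_refl|]. split; [exists r; split; auto; apply le_refl|].
        intros r' hr' hQr'. apply hno'. eauto.
      * intros h. destruct (hdec u) as (t & ht & hQt). exists t. split; auto.
        apply NNPP. intros hnt.
        destruct (proj2 (hsome (fun u t => ~ exists r, r < t /\ Q u r) u))
          as [w hw]; [eauto|]. apply (h w hw).
    + exists X. intros u.
      rewrite hX, (hsome (fun u t => exists r, r < t /\ Q u r)). split.
      * intros (t & _ & r & _ & hr). eauto.
      * intros hu. destruct (hdec u) as (t & ht & hQt). exists t.
        split; auto. apply hQt, hu.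
Qed.

Lemma stage_space_infinite : ~ finite_space S.
Proof. intros [b hb]. apply (lt_irrefl b), hb, hpts. Qed.

End StageSpace.

Lemma ACA_of_discrete_effectively_compact_finite :
  discrete_effectively_compact_finite M -> arithmetical_comprehension M.
Proof.
  intros h. apply ACA_iff_Sigma1_comprehension. intros Q hQ.
  apply NNPP. intros hno.
  destruct (stage_space_exists Q hQ) as (S & hpts & hidx & hU & hsel).
  apply (stage_space_infinite S hpts), h.
  - apply (stage_space_csc Q); auto.
  - apply (stage_space_discrete Q); auto.
  - split; [apply (stage_space_compact Q); auto|].
    apply (stage_space_cover_relation Q); auto.
Qed.

End RCA.

(** * Assembling the equivalences *)

Theorem mainTheorem1 (M : L2structure) (hM : RCA0 M) :
  (discrete_compact_finite M <-> arithmetical_comprehension M) /\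
  (discrete_effectively_compact_finite M <-> arithmetical_comprehension M) /\
  (compact_sequentially_compact M <-> arithmetical_comprehension M) /\
  (effectively_compact_sequentially_compact M <-> arithmetical_comprehension M).
Proof.
  pose proof (accumulation_points_of_ACA hM) as aca2.
  pose proof (ACA_of_discrete_effectively_compact_finite hM) as back.
  assert (i1 : compact_sequentially_compact M -> discrete_compact_finite M).
  { intros h S hS hd hc. apply (finite_of_sequentially_compact hM); auto. }
  assert (i2 : effectively_compact_sequentially_compact M ->
    discrete_effectively_compact_finite M).
  { intros h S hS hd hc. apply (finite_of_sequentially_compact hM); auto. }
  assert (i3 : discrete_compact_finite M -> discrete_effectively_compact_finite M).
  { intros h S hS hd hc. apply h; auto. apply hc. }
  assert (i4 : compact_sequentially_compact M ->
    effectively_compact_sequentially_compact M).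
  { intros h S hS hc. apply h; auto. apply hc. }
  (* Arithmetical comprehension gives (2), which gives (1) and (2'); each of these gives (1'), which
     gives arithmetical comprehension back. *)
  tauto.
Qed.
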